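(* Let $K\subseteq\mathbb{R}^m$ be a closed pointed convex cone with nonempty interior, $\{0_m\}\neq K\subsetneq\mathbb{R}^m$, and let $\overline{A}\in\mathbb{R}^{m\times n}$, $\overline b\in\mathbb{R}^m$ be such that $\{x\in\mathbb{R}^n:\overline Ax+\overline b\in -K\}\neq\emptyset$. Let $\mathcal B$ be a compact base of $K^\ast$. Then $$\mathrm{dist}\big(0_{n+1},E(\overline A,\overline b,\mathcal B)\big)=\inf_{(z,s,t,\lambda)\in\mathbb{R}^n\times\mathbb{R}\times\mathbb{R}\times\mathbb{R}^m}\Big\{t:\ \|(z,s)\|\le t,\ z=\overline A^T\lambda,\ s\ge-\overline b^T\lambda,\ \lambda\in\mathcal B\Big\}.$$ In particular, if $\mathcal B$ is a spectrahedron of the form $\mathcal B=\{\lambda\in\mathbb{R}^m:B_0+\sum_{i=1}^m\lambda_iB_i\succeq0\}$ for some symmetric $(p\times p)$ matrices $B_0,B_1,\dots,B_m$, then $$\mathrm{dist}\big(0_{n+1},E(\overline A,\overline b,\mathcal B)\big)=\sqrt{f^\ast},$$ where $f^\ast$ is the optimal value of the semidefinite program $$\inf_{(z,s,t,\lambda)\in\mathbb{R}^n\times\mathbb{R}\times\mathbb{R}\times\mathbb{R}^m}\left\{t:\ \begin{bmatrix} tI_n & 0_n & z \\ 0_n^T & t & s \\ z^T & s & 1 \end{bmatrix}\succeq0,\ z=\overline A^T\lambda,\ s\ge-\overline b^T\lambda,\ B_0+\sum_{i=1}^m\lambda_iB_i\succeq0\right\}.$$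
   Context: $\|\cdot\|$ is the Euclidean norm and $\mathrm{dist}(x,X)=\inf_{y\in X}\|x-y\|$. $M\succeq0$ means that the symmetric matrix $M$ is positive semidefinite. The dual cone is $K^\ast=\{a\in\mathbb{R}^m:a^Tx\ge 0\ \forall x\in K\}$. A compact base of $K^\ast$ is a compact convex set $\mathcal B\subseteq K^\ast$ with $0_m\notin\mathcal B$ and $K^\ast=\mathbb{R}_+\mathcal B$. The epigraphical set is $E(\overline A,\overline b,\mathcal B)=\{(\overline A^T\lambda,\,-\overline b^T\lambda):\lambda\in\mathcal B\}+\{0_n\}\times\mathbb{R}_+\subseteq\mathbb{R}^{n+1}$. *)

(* Defs.v *)
From HB Require Import structures.
From mathcomp Require Import all_boot all_order all_algebra.
From mathcomp Require Import all_classical all_reals all_analysis.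

Set Implicit Arguments.
Unset Strict Implicit.
Unset Printing Implicit Defensive.

Import Order.TTheory GRing.Theory Num.Theory.
Import numFieldNormedType.Exports.

Local Open Scope classical_set_scope.
Local Open Scope ring_scope.

Section Defs.
Context {R : realType}.

Definition dot {n : nat} (u v : 'cV[R]_n) : R := (u^T *m v) 0 0.

(* The library norm on matrices is the sup norm, so the Euclidean norm is
   defined separately; the topology on 'cV[R]_n is the same for both. *)
Definition enorm {n : nat} (u : 'cV[R]_n) : R :=
  Num.sqrt (\sum_(i < n) u i 0 ^+ 2).

(* The infimum is taken in the extended reals, with inf set0 = +oo. *)
Definition dist {n : nat} (x : 'cV[R]_n) (X : set 'cV[R]_n) : \bar R :=
  ereal_inf [set (enorm (x - y))%:E | y in X].

Definition psd {n : nat} (M : 'M[R]_n) : Prop :=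
  M \is symmetricmx /\ forall v : 'cV[R]_n, 0 <= dot v (M *m v).

Definition nonneg_reals : set R := [set r | 0 <= r].

Definition convex_cone {m : nat} (K : set 'cV[R]_m) : Prop :=
  convex_set (K : set (convex_lmodType 'cV[R]_m)) /\
  forall r x, 0 <= r -> K x -> K (r *: x).

Definition pointed {m : nat} (K : set 'cV[R]_m) : Prop :=
  K `&` (-%R @` K) = [set 0].

Definition dual_cone {m : nat} (K : set 'cV[R]_m) : set 'cV[R]_m :=
  [set a | forall x, K x -> 0 <= dot a x].

Definition compact_base {m : nat} (C B : set 'cV[R]_m) : Prop :=
  [/\ compact B,
      convex_set (B : set (convex_lmodType 'cV[R]_m)),
      B `<=` C,
      ~ B 0 &
      C = [set r *: l | r in nonneg_reals & l in B]].

Definition epigraphical_set {m n : nat} (A : 'M[R]_(m, n)) (b : 'cV[R]_m)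
    (B : set 'cV[R]_m) : set 'cV[R]_(n + 1) :=
  [set u + v | u in [set col_mx (A^T *m l) (- dot b l)%:M | l in B]
             & v in [set col_mx 0 r%:M | r in nonneg_reals]].

Definition lmi {m p : nat} (B0 : 'M[R]_p) (Bs : 'I_m -> 'M[R]_p)
    (l : 'cV[R]_m) : 'M[R]_p :=
  B0 + \sum_(i < m) l i 0 *: Bs i.

(* [ t I_n  0  z ; 0  t  s ; z^T  s  1 ] *)
Definition sdp_block {n : nat} (z : 'cV[R]_n) (s t : R) : 'M[R]_(n + 1 + 1) :=
  block_mx (block_mx t%:M 0 0 t%:M) (col_mx z s%:M) (row_mx z^T s%:M) 1%:M.

End Defs.

(* Main.v *)
Require Import Defs.
From HB Require Import structures.
From mathcomp Require Import all_boot all_order all_algebra.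
From mathcomp Require Import all_classical all_reals all_analysis.
From mathcomp Require Import ring lra.

Set Implicit Arguments.
Unset Strict Implicit.
Unset Printing Implicit Defensive.

Import Order.TTheory GRing.Theory Num.Theory.
Import numFieldNormedType.Exports.

Local Open Scope classical_set_scope.
Local Open Scope ring_scope.

(** Since [s] ranges over all reals above [- b^T l], the feasible pairs [(z, s)]
    of both programs are exactly the points of the epigraphical set. By a Schur
    complement, the matrix inequality says [|(z, s)|^2 <= t], so the
    semidefinite program minimizes the squared norm over that set, and the
    square root, being monotone, commutes with the infimum. *)

Lemma dotC (R : realType) (n : nat) (u v : 'cV[R]_n) : dot u v = dot v u.
Proof.
by rewrite /dot !mxE; apply: eq_bigr => i _; rewrite !mxE mulrC.
Qed.

Lemma dotDr (R : realType) (n : nat) (u v w : 'cV[R]_n) :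
  dot u (v + w) = dot u v + dot u w.
Proof. by rewrite /dot mulmxDr mxE. Qed.

Lemma dotZr (R : realType) (n : nat) (a : R) (u v : 'cV[R]_n) :
  dot u (a *: v) = a * dot u v.
Proof. by rewrite /dot -scalemxAr mxE. Qed.

Lemma dot_sqr (R : realType) (n : nat) (u : 'cV[R]_n) :
  dot u u = enorm u ^+ 2.
Proof.
rewrite /enorm sqr_sqrtr; last by apply: sumr_ge0 => i _; exact: sqr_ge0.
by rewrite /dot mxE; apply: eq_bigr => i _; rewrite mxE expr2.
Qed.

Lemma dot_self_ge0 (R : realType) (n : nat) (u : 'cV[R]_n) : 0 <= dot u u.
Proof. by rewrite dot_sqr sqr_ge0. Qed.

Lemma dot_self_eq0 (R : realType) (n : nat) (u : 'cV[R]_n) :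
  dot u u = 0 -> u = 0.
Proof.
rewrite /dot mxE => /psumr_eq0P u0; apply/colP => i; apply/eqP.
have := u0 _ i isT; rewrite !mxE -expr2 => /(_ _)/eqP; rewrite sqrf_eq0; apply.
by move=> j _; rewrite mxE -expr2 sqr_ge0.
Qed.

Lemma dot_col_mx (R : realType) (n k : nat) (u v : 'cV[R]_n) (x y : 'cV[R]_k) :
  dot (col_mx u x) (col_mx v y) = dot u v + dot x y.
Proof. by rewrite /dot tr_col_mx mul_row_col mxE. Qed.

Lemma dot_scalar (R : realType) (a b : R) :
  dot (a%:M : 'cV[R]_1) (b%:M : 'cV[R]_1) = a * b.
Proof. by rewrite /dot tr_scalar_mx -scalar_mxM mxE mulr1n. Qed.

(** With the form expanded into scalars, both directions of the Schur complement become real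
    arithmetic. *)
Lemma dot_block_mx (R : realType) (n : nat) (w x : 'cV[R]_n) (t c : R) :
  dot (col_mx x (c%:M : 'cV[R]_1)) (block_mx t%:M w w^T 1%:M *m col_mx x c%:M) =
  t * dot x x + 2 * c * dot w x + c ^+ 2.
Proof.
have -> : block_mx t%:M w w^T 1%:M *m col_mx x c%:M =
    col_mx (t *: x + c *: w) ((dot w x + c)%:M : 'cV[R]_1).
  rewrite mul_block_col !mul_scalar_mx scale1r mul_mx_scalar raddfD /=.
  by rewrite /dot -mx11_scalar.
by rewrite dot_col_mx dotDr !dotZr dot_scalar (dotC x w); ring.
Qed.

(** A well-chosen test vector gives one direction, completing the square the other. For [n = 0] the
    matrix is just [1], which puts no constraint on [t]; hence [0 < n]. *)
Lemma psd_schur (R : realType) (n : nat) (w : 'cV[R]_n) (t : R) :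
  (0 < n)%N ->
  psd (block_mx t%:M w w^T (1%:M : 'M[R]_1)) <-> enorm w ^+ 2 <= t.
Proof.
case: n w => // n w _; rewrite -dot_sqr; split=> [[_ M_ge0] | qt].
(* Writing [q = dot w w], the form at [(w, -q)] equals [q * (t - q)], which settles the case
   [q > 0]. *)
- have := M_ge0 (col_mx w (- dot w w)%:M); rewrite dot_block_mx => h.
  have [q0|q_neq0] := eqVneq (dot w w) 0; last first.
    have q_gt0 : 0 < dot w w by rewrite lt_def q_neq0 dot_self_ge0.
    by rewrite -(ler_pM2r q_gt0); lra.
  (* If [q = 0], a unit vector in the first block isolates [t] and gives [0 <= t]. *)
  have := M_ge0 (col_mx (delta_mx 0 0) 0%:M); rewrite dot_block_mx q0.
  suff -> : dot (delta_mx 0 0 : 'cV[R]_n.+1) (delta_mx 0 0) = 1 by lra.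
  by rewrite /dot trmx_delta mul_delta_mx mxE !eqxx.
- split.
    apply/is_hermitianmxP.
    by rewrite expr0 scale1r map_mx_id // tr_block_mx !tr_scalar_mx trmxK.
  move=> v; rewrite -(vsubmxK v) (mx11_scalar (dsubmx v)) dot_block_mx.
  set x := usubmx v; set c := dsubmx v 0 0.
  (* For [t <= 0] the bound forces [w = 0] and [t = 0], and the form reduces to [c ^+ 2]. *)
  have [t_gt0|t_le0] := ltP 0 t; last first.
    have w0 : w = 0.
      apply: dot_self_eq0; apply/eqP.
      by rewrite eq_le dot_self_ge0 (le_trans qt t_le0).
    have t0 : t = 0.
      by apply/eqP; rewrite eq_le t_le0 (le_trans (dot_self_ge0 w)).
    rewrite w0 t0 dotC -(scale0r x) dotZr.
    by rewrite !mul0r mulr0 !add0r sqr_ge0.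
  (* t * (t|x|^2 + 2c<w,x> + c^2) >= |tx + cw|^2 *)
  rewrite -(pmulr_rge0 _ t_gt0).
  have := dot_self_ge0 (t *: x + c *: w).
  rewrite !dotDr !dotZr ![dot (_ + _) _]dotC !dotDr !dotZr (dotC x w).
  (* The two sides differ by [c ^+ 2 * (t - dot w w)]. *)
  have := ler_wpM2r (sqr_ge0 c) qt.
  lra.
Qed.

Lemma psd_sdp_block (R : realType) (n : nat) (z : 'cV[R]_n) (s t : R) :
  psd (sdp_block z s t) <-> enorm (col_mx z (s%:M : 'cV[R]_1)) ^+ 2 <= t.
Proof.
rewrite /sdp_block -scalar_mx_block.
have -> : row_mx z^T s%:M = (col_mx z (s%:M : 'cV[R]_1))^T.
  by rewrite tr_col_mx tr_scalar_mx.
(* The border [(z, s)] has [n + 1] entries, so it is nonempty even when [n = 0]. *)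
by apply: psd_schur; rewrite addn1.
Qed.

Lemma epigraphical_setP (R : realType) (m n : nat) (A : 'M[R]_(m, n))
    (b : 'cV[R]_m) (B : set 'cV[R]_m) (y : 'cV[R]_(n + 1)) :
  epigraphical_set A b B y <->
  exists (l : 'cV[R]_m) (s : R),
    [/\ y = col_mx (A^T *m l) s%:M, - dot b l <= s & B l].
Proof.
split=> [[_ [l Bl <-]] [_ [r r_ge0 <-]] <- | [l [s [-> ls Bl]]]].
  exists l, (- dot b l + r); split=> //.
    by rewrite add_col_mx addr0 raddfD.
  by rewrite lerDl.
exists (col_mx (A^T *m l) (- dot b l)%:M); first by exists l.
(* The vertical component is the slack of [s] above [- dot b l]. *)
exists (col_mx 0 (s + dot b l)%:M).
  by exists (s + dot b l) => //; rewrite /nonneg_reals /= -lerBlDr sub0r.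
by rewrite add_col_mx addr0 -raddfD /= addrC addrK.
Qed.

Lemma enormN (R : realType) (n : nat) (u : 'cV[R]_n) : enorm (- u) = enorm u.
Proof. by rewrite /enorm; under eq_bigr do rewrite mxE sqrrN. Qed.

Lemma enorm_ge0 (R : realType) (n : nat) (u : 'cV[R]_n) : 0 <= enorm u.
Proof. exact: sqrtr_ge0. Qed.

Lemma dist0E (R : realType) (n : nat) (X : set 'cV[R]_n) :
  dist 0 X = ereal_inf [set (enorm y)%:E | y in X].
Proof.
rewrite /dist; congr (ereal_inf _); apply: eq_imagel => y _.
by rewrite sub0r enormN.
Qed.

(** Passing to the upper closure of a set of values keeps its infimum; this brings in the objective
    variable [t] of both programs. *)
Lemma ereal_inf_image_upper (R : realType) (T : Type) (X : set T) (f : T -> R) :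
  ereal_inf [set (f x)%:E | x in X] =
  ereal_inf [set t%:E | t in [set t | exists2 x, X x & f x <= t]].
Proof.
apply/eqP; rewrite eq_le; apply/andP; split; apply: le_ereal_inf_tmp.
  move=> _ [t [x Xx fxt] <-]; apply: ge_ereal_inf.
  by exists (f x)%:E; [exists x | rewrite lee_fin].
move=> _ [x Xx <-]; apply: ereal_inf_lbound.
by exists (f x) => //; exists x.
Qed.

Lemma sqrte_ereal_inf_sqr (R : realType) (T : Type) (X : set T) (f : T -> R) :
  (forall x, 0 <= f x) ->
  sqrte (ereal_inf [set (f x ^+ 2)%:E | x in X]) =
  ereal_inf [set (f x)%:E | x in X].
Proof.
move=> f_ge0; set d := ereal_inf (image X (fun x => (f x)%:E)).
have d_ge0 : (0 <= d)%E.
  by apply: le_ereal_inf_tmp => _ [x _ <-]; rewrite lee_fin.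
have sqrte_f x : sqrte (f x ^+ 2)%:E = (f x)%:E.
  by rewrite /= sqrtr_sqr ger0_norm.
apply/eqP; rewrite eq_le; apply/andP; split.
  apply: le_ereal_inf_tmp => _ [x Xx <-]; rewrite -sqrte_f lee_sqrt.
    by apply: ereal_inf_lbound; exists x.
  by rewrite lee_fin sqr_ge0.
(* Comparing roots reduces this to [d <= f x]. The argument stays in the extended reals, so it also
   covers empty [X], where [d = +oo]. *)
have sqr_le : (d ^+ 2 <= ereal_inf [set (f x ^+ 2)%:E | x in X])%E.
  apply: le_ereal_inf_tmp => _ [x Xx <-].
  rewrite -lee_sqrt ?lee_fin ?sqr_ge0 // sqrte_f sqrte_sqr gee0_abs //.
  by apply: ereal_inf_lbound; exists x.
have d2_ge0 : (0 <= d ^+ 2)%E by rewrite expe_ge0.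
by rewrite -[leLHS]gee0_abs // -sqrte_sqr lee_sqrt // (le_trans d2_ge0).
Qed.

Theorem theorem3p2 (R : realType) (m n : nat)
    (K : set 'cV[R]_m) (A : 'M[R]_(m, n)) (b : 'cV[R]_m) (B : set 'cV[R]_m)
    (K_closed : closed K) (K_cone : convex_cone K) (K_pointed : pointed K)
    (K_int : interior K !=set0) (K_neq0 : K <> [set 0]) (K_neqT : K <> setT)
    (feasible : [set x : 'cV[R]_n | (-%R @` K) (A *m x + b)] !=set0)
    (B_base : compact_base (dual_cone K) B) :
  dist 0 (epigraphical_set A b B) =
    ereal_inf [set t%:E | t in [set t : R |
      exists (z : 'cV[R]_n) (s : R) (l : 'cV[R]_m),
        [/\ enorm (col_mx z s%:M) <= t,
            z = A^T *m l,
            - dot b l <= s &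
            B l]]]
  /\
  (forall (p : nat) (B0 : 'M[R]_p) (Bs : 'I_m -> 'M[R]_p),
    B0 \is symmetricmx -> (forall i, Bs i \is symmetricmx) ->
    B = [set l | psd (lmi B0 Bs l)] ->
    dist 0 (epigraphical_set A b B) =
      sqrte (ereal_inf [set t%:E | t in [set t : R |
        exists (z : 'cV[R]_n) (s : R) (l : 'cV[R]_m),
          [/\ psd (sdp_block z s t),
              z = A^T *m l,
              - dot b l <= s &
              psd (lmi B0 Bs l)]]])).
Proof.
(* [Q] abstracts the constraint tying the norm to [t], so one identity serves both programs:
   [r <= t] for the first, [r ^+ 2 <= t] for the second. *)
have programE (Q : R -> R -> Prop) :
    [set t | exists2 y, epigraphical_set A b B y & Q (enorm y) t] =
    [set t | exists (z : 'cV[R]_n) (s : R) (l : 'cV[R]_m),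
      [/\ Q (enorm (col_mx z s%:M)) t, z = A^T *m l, - dot b l <= s & B l]].
  apply/seteqP; split=> t /= => [[y /epigraphical_setP[l [s [-> ls Bl]]] Qt] |].
    by exists (A^T *m l), s, l.
  move=> [z [s [l [Qt zE ls Bl]]]]; exists (col_mx z s%:M) => //.
  by apply/epigraphical_setP; exists l, s; rewrite -zE.
split.
  by rewrite dist0E ereal_inf_image_upper (programE (fun r t => r <= t)).
move=> p B0 Bs _ _ BE.
rewrite dist0E -sqrte_ereal_inf_sqr; last exact: enorm_ge0.
rewrite (ereal_inf_image_upper _ (fun y => enorm y ^+ 2)).
have /= -> := programE (fun r t => r ^+ 2 <= t).
congr (sqrte (ereal_inf (image _ _))); apply/seteqP.
by split=> t [z [s [l [zst zE ls Bl]]]]; exists z, s, l; split=> //;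
  [exact/psd_sdp_block | rewrite BE in Bl | exact/psd_sdp_block | rewrite BE].
Qed.
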